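(* Let $\mathbb{P}$ be a multiplicative subsemigroup of $\mathbb{N}=\{1,2,3,\dots\}$ with $\mathbb{P}\not\subseteq\{1\}$. Then every simple $\mathbb{P}$-torsion-free cone embeds strongly unitarily into a simple $\mathbb{P}$-torsion-free quasi-divisible refinement cone.
   Context: Commutative monoids are written additively. The algebraic preordering of a commutative monoid $M$ is $x\le y\iff(\exists z\in M)(x+z=y)$. A cone is a commutative monoid that is conical: $x+y=0\Rightarrow x=y=0$. A commutative monoid is $\mathbb{P}$-torsion-free if for all $p\in\mathbb{P}$, $px=py\Rightarrow x=y$. It is quasi-divisible if for every $x$ there are $u,v$ with $2u+3v=x$. An order-unit of $M$ is $u\in M$ such that every $x\in M$ satisfies $x\le nu$ for some positive integer $n$. $M$ is simple if every $u\in M$ with $u\not\le 0$ is an order-unit of $M$. A refinement cone is a cone with the refinement property: whenever $a_0+a_1=b_0+b_1$ there are $c_{ij}$ ($i,j<2$) with $a_i=c_{i0}+c_{i1}$ and $b_i=c_{0i}+c_{1i}$ for all $i<2$. A homomorphism $f:A\to B$ of commutative monoids is strongly unitary if it is one-to-one, has cofinal image (every $b\in B$ satisfies $b\le f(a)$ for some $a\in A$), for all $a_0,a_1\in A$, $b\in B$, $f(a_0)+b=f(a_1)$ implies $b\in f[A]$, and for all positive integers $m$ and $b\in B$, $mb\in f[A]$ implies $b\in f[A]$. ''$A$ embeds strongly unitarily into $B$'' means there is a strongly unitary homomorphism $A\to B$. *)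

(* Defs.v *)
From mathcomp Require Import all_boot ssralg.
From mathcomp Require Import classical_sets.

Set Implicit Arguments.
Unset Strict Implicit.
Unset Printing Implicit Defensive.

Import GRing.Theory.
Local Open Scope classical_set_scope.
Local Open Scope ring_scope.

(* Commutative monoids are [nmodType]s. The choice operator that this structure
   contains is no restriction classically: every type has one by
   [boolp.gen_choiceMixin]. *)

Definition alg_le (M : nmodType) (x y : M) : Prop := exists z : M, x + z = y.

Definition conical (M : nmodType) : Prop :=
  forall x y : M, x + y = 0 -> x = 0 /\ y = 0.

Definition torsion_free (P : set nat) (M : nmodType) : Prop :=
  forall p : nat, P p -> forall x y : M, x *+ p = y *+ p -> x = y.

Definition quasi_divisible (M : nmodType) : Prop :=
  forall x : M, exists u v : M, u *+ 2 + v *+ 3 = x.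

Definition order_unit (M : nmodType) (u : M) : Prop :=
  forall x : M, exists n : nat, (0 < n)%N /\ alg_le x (u *+ n).

Definition simple_monoid (M : nmodType) : Prop :=
  forall u : M, ~ alg_le u 0 -> order_unit u.

Definition refinement (M : nmodType) : Prop :=
  forall a0 a1 b0 b1 : M, a0 + a1 = b0 + b1 ->
    exists c00 c01 c10 c11 : M,
      [/\ a0 = c00 + c01, a1 = c10 + c11, b0 = c00 + c10 & b1 = c01 + c11].

Definition cofinal_image (A B : nmodType) (f : A -> B) : Prop :=
  forall b : B, exists a : A, alg_le b (f a).

Definition strongly_unitary (A B : nmodType) (f : {additive A -> B}) : Prop :=
  [/\ injective f,
      cofinal_image f,
      forall (a0 a1 : A) (b : B), f a0 + b = f a1 -> range f b
    & forall (m : nat) (b : B), (0 < m)%N -> range f (b *+ m) -> range f b].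

Definition mul_subsemigroup (P : set nat) : Prop :=
  (forall p, P p -> (0 < p)%N) /\
  (forall p q, P p -> P q -> P (p * q)%N).

(* Main.v *)
From HB Require Import structures.
Require Import Defs.
From mathcomp Require Import all_boot ssralg.
From mathcomp Require Import classical_sets.
From mathcomp Require Import ssrint boolp functions generic_quotient ring zify.
(* Multiplying by large elements of P shows that A minus 0 is cancellative, so
   it is a subsemigroup S of an abelian group G, in which S is archimedean.
   Freely adjoin to G solutions c of finite systems k_i c + x_i > 0, for all
   systems that have no consequence without c beyond S (or beyond the positive
   elements built so far), and iterate.  This gives a group H, with H / G
   torsion-free, and a semigroup T of positive elements of H that meets G in S
   and satisfies strict interpolation.  T need not be archimedean, but its order
   units form an archimedean semigroup containing S.  Since any two order units
   have a common order unit below them, and an order unit can be halved up to an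
   error, interpolants can be kept at distance at least an order unit from their
   bounds; hence the order units, with a new zero, form the required cone. *)

Set Implicit Arguments.
Unset Strict Implicit.
Unset Printing Implicit Defensive.

Import GRing.Theory.
Local Open Scope classical_set_scope.
Local Open Scope ring_scope.

(* The square-zero extension of [int] by [H] is only there to let [ring] prove
   identities in the abelian group [H]. *)
Definition sqzero (H : zmodType) : Type := int * H.

(** * Ring normalization for identities in abelian groups *)

Section SquareZero.
Variable H : zmodType.

HB.instance Definition _ := GRing.Zmodule.copy (sqzero H) (int * H)%type.

Definition sqzero_mul (a b : sqzero H) : sqzero H :=
  (a.1 * b.1, b.2 *~ a.1 + a.2 *~ b.1).

Lemma sqzero_mulA : associative sqzero_mul.
Proof.
move=> [a x] [b y] [c z]; congr pair => /=; first by rewrite mulrA.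
by rewrite !mulrzDl !mulrzA [y *~ a *~ c]mulrzAC [x *~ b *~ c]mulrzAC addrA
   [z *~ b *~ a]mulrzAC -!mulrzA (mulrC c b).
Qed.

Lemma sqzero_mulC : commutative sqzero_mul.
Proof. by move=> [a x] [b y]; congr pair => /=; rewrite 1?mulrC 1?addrC. Qed.

Lemma sqzero_mul1 : left_id ((1, 0) : sqzero H) sqzero_mul.
Proof. by move=> [a x]; rewrite /sqzero_mul /= mul1r mul0rz addr0. Qed.

Lemma sqzero_mulD : left_distributive sqzero_mul +%R.
Proof.
move=> [a x] [b y] [c z]; congr pair => /=; first by rewrite mulrDl.
by rewrite mulrzDl mulrzDr addrACA.
Qed.

Lemma sqzero_1neq0 : ((1, 0) : sqzero H) != 0.
Proof. by []. Qed.

HB.instance Definition _ := GRing.Zmodule_isComNzRing.Build (sqzero H)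
  sqzero_mulA sqzero_mulC sqzero_mul1 sqzero_mulD sqzero_1neq0.

Definition to_sqzero (x : H) : sqzero H := (0, x).

Lemma to_sqzero_zmod_morphism : zmod_morphism to_sqzero.
Proof. by move=> x y; congr pair; rewrite /= subr0. Qed.

HB.instance Definition _ := GRing.isZmodMorphism.Build H (sqzero H) to_sqzero
  to_sqzero_zmod_morphism.

Lemma to_sqzero_inj : injective to_sqzero.
Proof. by move=> x y []. Qed.

End SquareZero.

Ltac abel := apply: to_sqzero_inj; ring.


(** * Subsemigroups with 0 adjoined *)

Section WithZero.
Variables (M : nmodType) (T : set M).
Hypothesis TD : forall x y, T x -> T y -> T (x + y).

(** A semigroup of positive elements need not contain 0, so combinations whose multiplicities may
    vanish land here; adding one genuine element of [T] leads back into [T]. *)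
Definition with_zero : set M := fun x => x = 0 \/ T x.

Lemma with_zeroD x y : with_zero x -> with_zero y -> with_zero (x + y).
Proof.
by move=> [->|Tx] [->|Ty]; rewrite ?add0r ?addr0; [left|right..|right; apply: TD].
Qed.

Lemma with_zeroDl x y : with_zero x -> T y -> T (x + y).
Proof. by move=> [->|Tx] Ty; rewrite ?add0r //; apply: TD. Qed.

Lemma with_zeroMn x n : with_zero x -> with_zero (x *+ n).
Proof.
by move=> Tx; elim: n => [|n IH]; [left|rewrite mulrS; apply: with_zeroD].
Qed.

Lemma semigroupMn x n : (0 < n)%N -> T x -> T (x *+ n).
Proof.
by case: n => // n _ Tx; rewrite mulrSr; apply: with_zeroDl (with_zeroMn _ _) _;
  first right.
Qed.

End WithZero.

(** * Terms, variables and the ambient group *)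

(* [term] names the elements of [tower] reached by finitely many adjunctions;
   [Var k x] is the solution adjoined for the system [k i * c + x i > 0], and the
   [label] of that solution is the system itself. *)
Section Tower.
Variables (G : zmodType) (S : set G).
Hypothesis SD : forall x y, S x -> S y -> S (x + y).

Inductive term :=
  | Const of G
  | Minus of term & term
  | Var of ('I_4 -> int) & ('I_4 -> term).

(** Labels contain functions; [{classic _}] supplies the decidable equality that [var] needs. *)
Definition label := {classic ('I_4 -> int) * ('I_4 -> term)}.

(** All variables are adjoined to [G] at once, with no finite-support condition; [finitary] later
    singles out the elements that terms name. *)
Definition tower := (G * (label -> int))%type.

Definition base (g : G) : tower := (g, 0).

Definition coef (l : label) (h : tower) : int := h.2 l.
Arguments coef : simpl never.

Definition var (l : label) : tower := (0, fun l' => (l' == l)%:R).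

Lemma base_zmod_morphism : zmod_morphism base.
Proof. by move=> x y; congr pair; rewrite /= subr0. Qed.

HB.instance Definition _ := GRing.isZmodMorphism.Build G tower base
  base_zmod_morphism.

Lemma coef_zmod_morphism l : zmod_morphism (coef l).
Proof. by []. Qed.

HB.instance Definition _ l := GRing.isZmodMorphism.Build tower int (coef l)
  (coef_zmod_morphism l).

Lemma coef_var l l' : coef l' (var l) = (l' == l)%:R.
Proof. by []. Qed.

Fixpoint eval (t : term) : tower :=
  match t with
  | Const g => base g
  | Minus t1 t2 => eval t1 - eval t2
  | Var k x => var (k, x)
  end.

Fixpoint height (t : term) : nat :=
  match t with
  | Const _ => 0%N
  | Minus t1 t2 => maxn (height t1) (height t2)
  | Var _ x => (\max_i height (x i)).+1
  end.

(** A system of rank n has its constants below n, so its variable can be adjoined in the step from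
    stage n to stage n + 1. *)
Definition rank (l : label) : nat := \max_i height (l.2 i).

Definition below (n : nat) (h : tower) : Prop :=
  forall l, (n <= rank l)%N -> coef l h = 0.

Lemma belowD n x y : below n x -> below n y -> below n (x + y).
Proof. by move=> bx yb l nl; rewrite raddfD /= bx // yb // addr0. Qed.

Lemma belowB n x y : below n x -> below n y -> below n (x - y).
Proof. by move=> bx yb l nl; rewrite raddfB /= bx // yb // subr0. Qed.

Lemma belowMz n x (k : int) : below n x -> below n (x *~ k).
Proof. by move=> bx l nl; rewrite raddfMz /= bx // mul0rz. Qed.

Lemma belowW m n x : (m <= n)%N -> below m x -> below n x.
Proof. by move=> mn bx l nl; apply: bx; apply: leq_trans nl. Qed.

Lemma below_base n g : below n (base g).
Proof. by []. Qed.

Lemma below_var l : below (rank l).+1 (var l).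
Proof.
by move=> l' ll'; rewrite coef_var; case: eqP ll' => // ->; rewrite ltnn.
Qed.

Lemma below_eval t : below (height t) (eval t).
Proof.
elim: t => [g|t1 IH1 t2 IH2|k x _] /=; first exact: below_base.
  by apply: belowB; [apply: belowW IH1|apply: belowW IH2];
    rewrite ?leq_maxl ?leq_maxr.
exact: (@below_var (k, x)).
Qed.

(** * Generators and stages of positive elements *)

Definition gen (e : label * 'I_4) : tower :=
  var e.1 *~ e.1.1 e.2 + eval (e.1.2 e.2).

(* The second condition bounds every generator attached to [l] from above. *)
Definition admissible (Q : set tower) (l : label) : Prop :=
  (forall m : 'I_4 -> nat, (exists i, 0 < m i)%N ->
     \sum_i l.1 i *+ m i = 0 -> Q (\sum_i eval (l.2 i) *+ m i)) /\
  (exists2 m : 'I_4 -> nat, forall i, (0 < m i)%N & \sum_i l.1 i *+ m i = 0).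

Inductive semigroup_closure (Q : set tower) : set tower :=
  | closure_sub x : Q x -> semigroup_closure Q x
  | closure_add x y : semigroup_closure Q x -> semigroup_closure Q y ->
      semigroup_closure Q (x + y).

Definition new_gen (Q : set tower) (n : nat) (e : label * 'I_4) : Prop :=
  rank e.1 = n /\ admissible Q e.1.

(** All admissible systems of rank n are adjoined simultaneously. Testing admissibility against
    [stage n] is enough, as later stages add nothing below n. *)
Fixpoint stage (n : nat) : set tower :=
  match n with
  | 0 => base @` S
  | n.+1 => semigroup_closure (stage n `|` gen @` new_gen (stage n) n)
  end.

Lemma below_gen e : below (rank e.1).+1 (gen e).
Proof.
apply: belowD; first exact/belowMz/below_var.
apply: (belowW _ (@below_eval _)); apply: leqW.
by rewrite /rank (@leq_bigmax _ (fun i => height (e.1.2 i))).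
Qed.

Lemma stage_below n h : stage n h -> below n h.
Proof.
elim: n h => [|n IH] h /=; first by case=> g _ <-; apply: below_base.
elim=> {h} [x [/IH|[e [<- _] <-]]|x y _ IHx _ IHy].
- exact: belowW.
- exact: below_gen.
- exact: belowD.
Qed.

Lemma stageS n h : stage n h -> stage n.+1 h.
Proof. by move=> nh; apply: closure_sub; left. Qed.

Lemma stageW m n h : (m <= n)%N -> stage m h -> stage n h.
Proof.
by move=> /subnK <-; elim: (n - m)%N => // d IH /IH; rewrite addSn; apply: stageS.
Qed.

Lemma stageD n x y : stage n x -> stage n y -> stage n (x + y).
Proof.
case: n => [|n] /=; last exact: closure_add.
by move=> [a Sa <-] [b Sb <-]; exists (a + b); [apply: SD|rewrite raddfD].
Qed.

(** The constant of a generator lies below the rank of its label, so labels of that rank see only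
    the leading term. *)
Lemma coef_gen l e : rank l = rank e.1 ->
  coef l (gen e) = if l == e.1 then e.1.1 e.2 else 0.
Proof.
move=> le; rewrite raddfD /= raddfMz /= coef_var (@below_eval (e.1.2 e.2)).
  by case: eqP => _; rewrite addr0 ?mul0rz // intz.
by rewrite le /rank (@leq_bigmax _ (fun i => height (e.1.2 i))).
Qed.

(** * Conservativity of the stages *)

Lemma sum_count (I : finType) (V : nmodType) (s : seq I) (F : I -> V) :
  \sum_(i <- s) F i = \sum_i F i *+ count_mem i s.
Proof.
elim: s => [|j s IH]; first by rewrite big_nil big1.
rewrite big_cons IH /=; under [RHS]eq_bigr do rewrite mulrnDr.
rewrite big_split /=; congr (_ + _).
rewrite (bigD1 j) //= eqxx big1 ?addr0 // => i.
by rewrite eq_sym => /negPf ->.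
Qed.

(* The generators attached to one label have total coefficient 0, so by
   admissibility their sum already lies in the previous stage. *)
Lemma stage_sum_gen n (s : seq (label * 'I_4)) :
  {in s, forall e, new_gen (stage n) n e} ->
  (forall l, rank l = n -> coef l (\sum_(e <- s) gen e) = 0) ->
  s = [::] \/ stage n (\sum_(e <- s) gen e).
Proof.
(* Each round of the induction removes all generators that carry the label of the head. *)
have [N] := ubnP (size s).
elim: N s => // N IH [|e0 s0]; first by left.
move: (mem_head e0 s0); move: (e0 :: s0) => s e0s sN sP sC; right.
have [rl adl] : new_gen (stage n) n e0 by apply: sP.
pose l := e0.1; pose a (e : label * 'I_4) := e.1 == l.
have E : \sum_(e <- s) gen e =
    \sum_(e <- filter a s) gen e + \sum_(e <- filter (predC a) s) gen e.
  by rewrite !big_filter; apply: bigID.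
pose s1 := [seq e.2 | e <- filter a s].
have sub1 (V : nmodType) (F : label -> 'I_4 -> V) :
    \sum_(e <- filter a s) F e.1 e.2 = \sum_i F l i *+ count_mem i s1.
  rewrite -(sum_count s1 (F l)) big_map big_seq [RHS]big_seq; apply: eq_bigr => e.
  by rewrite mem_filter => /andP[/eqP ->].
have k1 : \sum_i l.1 i *+ count_mem i s1 = 0.
  rewrite -(sub1 _ (fun l i => l.1 i)) -[RHS](sC l rl) raddf_sum /= big_filter.
  rewrite big_mkcond big_seq [RHS]big_seq.
  apply: eq_bigr => e es; rewrite coef_gen ?(sP e es).1 //.
  by rewrite /a eq_sym.
have T1 : stage n (\sum_(e <- filter a s) gen e).
  rewrite [X in stage n X](_ :
      _ = \sum_i eval (l.2 i) *+ count_mem i s1); last first.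
    rewrite -(sub1 _ (fun l i => eval (l.2 i))) /gen big_split /=.
    rewrite (sub1 _ (fun l i => var l *~ l.1 i)).
    rewrite -[RHS]add0r; congr (_ + _).
    transitivity (var l *~ (\sum_i l.1 i *+ count_mem i s1)); last by rewrite k1.
    rewrite mulrz_sumr; apply: eq_bigr => i _.
    by rewrite -[_ i *+ _]mulr_natr mulrzA mulrz_nat.
  apply: adl.1 k1; exists e0.2; rewrite -has_count has_pred1.
  by apply: map_f; rewrite mem_filter /a eqxx.
rewrite E; case: (IH (filter (predC a) s)).
- have : (0 < count a s)%N
    by rewrite -has_count; apply/hasP; exists e0; rewrite // /a eqxx.
  by rewrite size_filter; move: sN (count_predC a s); lia.
- by move=> e; rewrite mem_filter => /andP[_ /sP].
- move=> l' rl'; move: (sC l' rl'); rewrite E raddfD /= (stage_below T1) ?rl' //.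
  by rewrite add0r.
- by move=> ->; rewrite big_nil addr0.
- exact: stageD.
Qed.

(** Remove from h its part in stage n, if any: what remains is a sum of new generators that is still
    below n, so its coefficients of rank n vanish and [stage_sum_gen] applies. *)
Lemma stage_conservative_step n h : stage n.+1 h -> below n h -> stage n h.
Proof.
move=> hS hn.
(* The two forms are kept apart because 0 need not lie in [stage n]. *)
have [s sP hE] : exists2 s : seq (label * 'I_4),
    {in s, forall e, new_gen (stage n) n e} &
    (s <> [::] /\ h = \sum_(e <- s) gen e) \/
    (exists2 p, stage n p & h = p + \sum_(e <- s) gen e).
  elim: hS {hn} => {h} [x [xn|[e eP <-]]|x y _ [s sP hx] _ [s' sP' hy]].
  - by exists [::] => //; right; exists x; rewrite // big_nil addr0.
  - exists [:: e]; last by left; rewrite big_seq1.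
    by move=> e'; rewrite inE => /eqP ->.
  - exists (s ++ s'); first by move=> e; rewrite mem_cat => /orP[/sP|/sP'].
    rewrite big_cat; case: hx hy => [[s0 ->]|[p pn ->]] [[_ ->]|[q qn ->]].
    + by left; split=> //; case: (s) s0.
    + by right; exists q; rewrite // addrCA.
    + by right; exists p; rewrite // addrA.
    + by right; exists (p + q); [apply: stageD|rewrite addrACA].
have sumE : below n (\sum_(e <- s) gen e).
  case: hE => [[_ <-] //|[p pn hE]].
  rewrite (_ : \sum_(e <- s) gen e = h - p); last by rewrite hE addrC addKr.
  exact/belowB/stage_below.
have sC l : rank l = n -> coef l (\sum_(e <- s) gen e) = 0.
  by move=> rl; apply: sumE; rewrite rl.
have := stage_sum_gen sP sC; case: hE => [[s0 ->] [//|]|[p pn ->]] //.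
by case=> [->|]; [rewrite big_nil addr0|apply: stageD].
Qed.

Lemma stage_conservative m n h : stage m h -> below n h -> stage n h.
Proof.
move=> mh nh; have [/stageW|/ltnW/subnK] := leqP m n; first exact.
move: mh => /[swap] <-; elim: (m - n)%N => // d IH dh; apply: IH.
by apply: stage_conservative_step => //; apply: belowW nh; apply: leq_addl.
Qed.

(** * The positive semigroup and the solution of systems in it *)

Definition positive (h : tower) : Prop := exists n, stage n h.

Lemma positiveD x y : positive x -> positive y -> positive (x + y).
Proof.
move=> [m xm] [n yn]; exists (maxn m n).
by apply: stageD; [apply: stageW xm|apply: stageW yn];
  rewrite ?leq_maxl ?leq_maxr.
Qed.

Lemma positive_base g : positive (base g) <-> S g.
Proof.
split=> [[n gn]|Sg]; last by exists 0%N, g.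
have [g' Sg' [<-] //] : stage 0 (base g).
exact: stage_conservative gn (@below_base 0%N g).
Qed.

(** Only elements named by a term can occur as constants of a label, hence of a system to be
    solved. *)
Definition finitary (h : tower) : Prop := exists t, eval t = h.

Lemma finitary_base g : finitary (base g).
Proof. by exists (Const g). Qed.

Lemma finitaryB x y : finitary x -> finitary y -> finitary (x - y).
Proof. by move=> [s <-] [t <-]; exists (Minus s t). Qed.

Lemma finitaryN x : finitary x -> finitary (- x).
Proof. by rewrite -sub0r -(raddf0 base); apply/finitaryB/finitary_base. Qed.

Lemma finitaryD x y : finitary x -> finitary y -> finitary (x + y).
Proof. by rewrite -{2}[y]opprK => fx /finitaryN; apply: finitaryB. Qed.

Lemma finitaryMn x n : finitary x -> finitary (x *+ n).
Proof.
move=> fx; elim: n => [|n IH]; first exact: (finitary_base 0).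
by rewrite mulrS; apply: finitaryD.
Qed.

Lemma finitaryMz x (k : int) : finitary x -> finitary (x *~ k).
Proof. by case: k => n fx; last apply: finitaryN; apply: finitaryMn. Qed.

Lemma finitary_positive h : positive h -> finitary h.
Proof.
case=> n; elim: n h => [|n IH] h /=; first by case=> g _ <-; apply: finitary_base.
elim=> {h} [x [/IH //|[[[k y] i] _ <-]]|x y _ fx _ fy]; last exact: finitaryD.
apply: finitaryD; last by exists (y i).
by apply: finitaryMz; exists (Var k y).
Qed.

(** The solution is the variable labelled by the system itself. Consequences free of c are positive
    at some stage and involve only variables below the rank of the label, so conservativity makes
    the label admissible. *)
Lemma positive_solve (k : 'I_4 -> int) (x : 'I_4 -> tower) :
    (forall i, finitary (x i)) ->
    (forall m : 'I_4 -> nat, (exists i, 0 < m i)%N ->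
       \sum_i k i *+ m i = 0 -> positive (\sum_i x i *+ m i)) ->
    (exists2 m : 'I_4 -> nat, forall i, (0 < m i)%N & \sum_i k i *+ m i = 0) ->
  exists2 c, finitary c & forall i, positive (c *~ k i + x i).
Proof.
move=> /choice[t tx] pos ex; pose l : label := (k, t); exists (var l).
  by exists (Var k t).
have adl : admissible (stage (rank l)) l.
  split=> // m m0 km; have [n xn] := pos m m0 km.
  under eq_bigr do rewrite /= tx.
  apply: stage_conservative xn _ => l' ll'.
  rewrite raddf_sum big1 // => i _; rewrite raddfMn /= -tx (@below_eval (t i)).
    by rewrite mul0rn.
  by apply: leq_trans ll'; rewrite /rank (@leq_bigmax _ (fun i => height (t i))).
move=> i; exists (rank l).+1; apply: closure_sub; right; exists (l, i) => //.
by rewrite /gen /= tx.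
Qed.

(** * Archimedean bounds by elements of [S] *)

Hypothesis S_arch : forall s x, S s -> S x -> exists n, S (s *+ n - x).

(** By induction on the stage: a generator is a summand of a combination in which the variable
    cancels. That combination lies in the earlier stage, and its other summands are positive or
    0. *)
Lemma positive_bounded s h : S s -> positive h ->
  exists n, positive (base s *+ n - h).
Proof.
move=> Ss [n]; elim: n h => [|n IH] h /=.
  case=> g Sg <-; have [n sg] := S_arch Ss Sg; exists n.
  by rewrite -raddfMn -raddfB; apply/positive_base.
elim=> {h} [x [/IH //|[[l i] [/= rl adl] <-]]|x y _ [a xa] _ [b yb]]; last first.
  by exists (a + b)%N; move: (positiveD xa yb); congr positive; abel.
have [m m0 km] := adl.2.
have pgen j : positive (gen (l, j)).
  by exists n.+1; apply: closure_sub; right; exists (l, j).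
have sumE : \sum_j gen (l, j) *+ m j = \sum_j eval (l.2 j) *+ m j.
  rewrite /gen /=; under eq_bigr do rewrite mulrnDl.
  rewrite big_split /= [X in X + _](_ : _ = var l *~ (\sum_j l.1 j *+ m j)).
    by rewrite km add0r.
  by rewrite mulrz_sumr; apply: eq_bigr => j _;
    rewrite -[_ j *+ _]mulr_natr mulrzA mulrz_nat.
have [N pN] : exists N, positive (base s *+ N - \sum_j gen (l, j) *+ m j).
  by apply: IH; rewrite sumE; apply: adl.1 km; exists i.

exists N; rewrite (bigD1 i) //= in pN.
have pD : forall x y, positive x -> positive y -> positive (x + y).
  exact: positiveD.
have w : with_zero positive (gen (l, i) *+ (m i).-1 +
    \sum_(j | j != i) gen (l, j) *+ m j).
  apply: (with_zeroD pD); first by apply: (with_zeroMn pD); right.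
  apply: (big_ind (with_zero positive)); first by left.
    exact: (with_zeroD pD).
  by move=> j _; apply: (with_zeroMn pD); right.
move: (with_zeroDl pD w pN); congr positive.
by rewrite -{2}(prednK (m0 i)) mulrS; abel.
Qed.

(** * Interpolation, division and common minorants *)

Lemma positive_comb3 a b c i j k : positive a -> positive b -> positive c ->
  (0 < i + j + k)%N -> positive (a *+ i + b *+ j + c *+ k).
Proof.
have pD : forall x y, positive x -> positive y -> positive (x + y).
  exact: positiveD.
have pM x n : positive x -> with_zero positive (x *+ n).
  by move=> px; apply: (with_zeroMn pD); right.
move=> pa pb pc ijk; rewrite -addrA.
case: i j k ijk => [|i] [|j] [|k] // _; rewrite ?mulr0n ?add0r ?addr0;
  repeat first [exact: semigroupMn|apply: positiveD].
Qed.

(** Four inequalities suffice for all the systems below; a shorter one is padded by repetition. *)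
Lemma positive_solve4 (k0 k1 k2 k3 : int) (x0 x1 x2 x3 : tower) :
    finitary x0 -> finitary x1 -> finitary x2 -> finitary x3 ->
    (forall m0 m1 m2 m3 : nat, (0 < m0 + m1 + m2 + m3)%N ->
       k0 * m0 + k1 * m1 + k2 * m2 + k3 * m3 = 0 ->
       positive (x0 *+ m0 + x1 *+ m1 + x2 *+ m2 + x3 *+ m3)) ->
    (exists m0 m1 m2 m3 : nat, (0 < m0 * m1 * m2 * m3)%N /\
       k0 * m0 + k1 * m1 + k2 * m2 + k3 * m3 = 0) ->
  exists2 c, finitary c & [/\ positive (c *~ k0 + x0), positive (c *~ k1 + x1),
    positive (c *~ k2 + x2) & positive (c *~ k3 + x3)].
Proof.
move=> f0 f1 f2 f3 pos [n0 [n1 [n2 [n3 [n_gt0 kn]]]]].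
have mulz_nat (a : int) (n : nat) : a * n = a *+ n.
  by rewrite -natz mulr_natr.
have sum4 (V : nmodType) (F : 'I_4 -> V) : \sum_i F i =
    F (Ordinal (isT : (0 < 4)%N)) + F (Ordinal (isT : (1 < 4)%N)) +
    F (Ordinal (isT : (2 < 4)%N)) + F (Ordinal (isT : (3 < 4)%N)).
  rewrite !big_ord_recl big_ord0 addr0 !addrA.
  by congr (F _ + F _ + F _ + F _); apply: val_inj.
pose k (i : 'I_4) := nth 0 [:: k0; k1; k2; k3] i.
pose x (i : 'I_4) := nth 0 [:: x0; x1; x2; x3] i.
have [|||c fc ck] := @positive_solve k x.
- by case=> [[|[|[|[|]]]]].
- move=> m [i mi]; rewrite !sum4 => km; apply: pos; last first.
    by rewrite -[RHS]km !mulz_nat.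
  by case: i mi => [[|[|[|[|]]]]] // p mi;
    rewrite (bool_irrelevance p isT) in mi; lia.
- exists (fun i : 'I_4 => nth 0%N [:: n0; n1; n2; n3] i).
    by case=> [[|[|[|[|]]]]] //= _; lia.
  by rewrite sum4 -[RHS]kn !mulz_nat.
exists c => //; split.
- exact: (ck (Ordinal (isT : (0 < 4)%N))).
- exact: (ck (Ordinal (isT : (1 < 4)%N))).
- exact: (ck (Ordinal (isT : (2 < 4)%N))).
- exact: (ck (Ordinal (isT : (3 < 4)%N))).
Qed.

Lemma positive_interpolation x0 x1 y0 y1 :
    finitary x0 -> finitary x1 -> finitary y0 -> finitary y1 ->
    positive (y0 - x0) -> positive (y0 - x1) -> positive (y1 - x0) ->
    positive (y1 - x1) ->
  exists2 c, finitary c & [/\ positive (c - x0), positive (c - x1),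
    positive (y0 - c) & positive (y1 - c)].
Proof.
move=> fx0 fx1 fy0 fy1 p00 p01 p10 p11.
have [||||m0 m1 m2 m3 m_gt0 mk||c fc [p0 p1 p2 p3]] :=
  @positive_solve4 1 1 (-1) (-1) (- x0) (- x1) y0 y1.
- exact: finitaryN.
- exact: finitaryN.
- by [].
- by [].
(* Since m0 + m1 = m2 + m3, lower and upper bounds can be matched in pairs y_j - x_i, beginning with
   x0 against y0. *)
- have [le02|le20] := leqP m0 m2.
    have [d Em2] : exists d, m2 = (m0 + d)%N by exists (m2 - m0)%N; lia.
    have Em1 : m1 = (d + m3)%N by lia.
    subst m1 m2.
    have : positive ((y0 - x0) *+ m0 + (y0 - x1) *+ d + (y1 - x1) *+ m3).
      by apply: positive_comb3 => //; lia.
    by congr positive; abel.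
  have [d Em0] : exists d, m0 = (m2 + d)%N by exists (m0 - m2)%N; lia.
  have Em3 : m3 = (d + m1)%N by lia.
  subst m0 m3.
  have : positive ((y0 - x0) *+ m2 + (y1 - x0) *+ d + (y1 - x1) *+ m1).
    by apply: positive_comb3 => //; lia.
  by congr positive; abel.
- by exists 1%N, 1%N, 1%N, 1%N.
by exists c => //; rewrite !mulrN1z in p2 p3; split=> //; rewrite addrC.
Qed.

(** Read the conditions as x/3 < w < x/2. Besides halving x up to an error, such a w splits x as
    2(3w - x) + 3(x - 2w). *)
Lemma positive_third_half x : positive x ->
  exists2 w, finitary w & positive (x - w *+ 2) /\ positive (w *+ 3 - x).
Proof.
move=> px; have fx := finitary_positive px.
have [||||m0 m1 m2 m3 m_gt0 mk||c fc [p0 p1 _ _]] :=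
  @positive_solve4 (-2) 3 (-2) 3 x (- x) x (- x).
- by [].
- exact: finitaryN.
- by [].
- exact: finitaryN.
(* Here 2(m0 + m2) = 3(m1 + m3), so the consequence is a positive multiple of x. *)
- have [d Ed] : exists d, (m0 + m2)%N = (m1 + m3 + d)%N.
    by exists (m0 + m2 - (m1 + m3))%N; lia.
  have : positive (x *+ d) by apply: semigroupMn => //; [exact: positiveD|lia].
  congr positive; transitivity (x *+ (m0 + m2) - x *+ (m1 + m3)).
    by rewrite Ed; abel.
  by abel.
- by exists 3%N, 2%N, 3%N, 2%N.
by exists c => //; split=> //; move: p0; congr positive; abel.
Qed.

(** The last bound makes r an order unit when p is one. With N in place of N + 1, the case N = 1
    would ask for r < p < r. *)
Lemma positive_common_minorant p q N : positive p -> positive q ->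
    (0 < N)%N -> positive (q *+ N - p) ->
  exists2 r, positive r &
    [/\ positive (p - r), positive (q - r) & positive (r *+ N.+1 - p)].
Proof.
move=> pp pq N_gt0 pN.
have fp := finitary_positive pp; have fq := finitary_positive pq.
have [||||m0 m1 m2 m3 m_gt0 mk||c fc [p0 p1 p2 p3]] :=
  @positive_solve4 (-1) (-1) N.+1%:Z 1 p q (- p) 0.
- by [].
- by [].
- exact: finitaryN.
- exact: (finitary_base 0).
- have m1E : (m0 + m1 = N.+1 * m2 + m3)%N by lia.
  have [le20|lt02] := leqP m2 m0.
    have [d Ed] : exists d, m0 = (m2 + d)%N by exists (m0 - m2)%N; lia.
    have : positive (p *+ d + q *+ m1 + q *+ 0).
      by apply: positive_comb3 => //; nia.
    by congr positive; rewrite Ed; abel.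
  (* The d surplus copies of -p are absorbed by copies of [q *+ N - p]: cancellation of c forces m1
     to be at least N d. *)
  have [d Ed] : exists d, m2 = (m0 + d)%N by exists (m2 - m0)%N; lia.
  have [e Ee] : exists e, m1 = (N * d + e)%N by exists (m1 - N * d)%N; nia.
  have : positive ((q *+ N - p) *+ d + q *+ e + q *+ 0).
    by apply: positive_comb3 => //; lia.
  by congr positive; rewrite Ed Ee; abel.
- by exists N.+1, N.+1, 1%N, N.+1; split; lia.
rewrite !mulrN1z addr0 in p0 p1 p2 p3.
by exists c => //; split=> //; rewrite addrC.
Qed.

(** * The semigroup of order units *)

Definition punit : set tower := fun t =>
  positive t /\ exists s n, S s /\ positive (t *+ n - base s).

Let pD : forall x y, positive x -> positive y -> positive (x + y) := positiveD.

Let pM x n : positive x -> with_zero positive (x *+ n).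
Proof. by move=> px; apply: (with_zeroMn pD); right. Qed.

Lemma punit_base s : S s -> punit (base s).
Proof.
move=> Ss; split; first exact/positive_base.
(* The factor is 2 because 1 would require 0 to be positive. *)
by exists s, 2%N; rewrite mulr2n addrK; split=> //; apply/positive_base.
Qed.

Lemma punitDl t h : positive h -> punit t -> punit (h + t).
Proof.
move=> ph [pt [s [n [Ss tn]]]]; split; first exact: positiveD.
exists s, n; split=> //; move: (with_zeroDl pD (pM n ph) tn).
by congr positive; abel.
Qed.

(** Multiples of s dominate every positive element, and a multiple of t dominates s; so members of
    [punit] are order units of [positive]. *)
Lemma punit_dominates t h : punit t -> positive h ->
  exists2 N, (0 < N)%N & positive (t *+ N - h).
Proof.
move=> [pt [s [n [Ss tn]]]] /(positive_bounded Ss)[m sm].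
exists (n * m).+1 => //; move: (positiveD pt (with_zeroDl pD (pM m tn) sm)).
by congr positive; abel.
Qed.

Lemma punit_of_multiple t r N :
  positive t -> punit r -> positive (t *+ N - r) -> punit t.
Proof.
move=> pt [_ [s [n [Ss rn]]]] tN; split=> //; exists s, (N * n)%N; split=> //.
by move: (with_zeroDl pD (pM n tN) rn); congr positive; abel.
Qed.

Lemma punit_common_minorant p q : punit p -> punit q ->
  exists2 r, punit r & positive (p - r) /\ positive (q - r).
Proof.
move=> up uq; have [N N_gt0 qN] := punit_dominates uq up.1.
have [r pr [r1 r2 r3]] := positive_common_minorant up.1 uq.1 N_gt0 qN.
by exists r => //; apply: punit_of_multiple r3.
Qed.

Lemma punit_halve x : punit x -> exists2 w, punit w & positive (x - w *+ 2).
Proof.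
move=> ux; have [w _ [w2 w3]] := positive_third_half ux.1.
have pw : positive w by move: (positiveD w2 w3); congr positive; abel.
by exists w => //; apply: punit_of_multiple w3.
Qed.

Lemma punit_quasi_divisible x : punit x ->
  exists u v, [/\ punit u, punit v & u *+ 2 + v *+ 3 = x].
Proof.
move=> ux; have [w1 u1 p1] := punit_halve ux.
have [w2 u2 p2] := punit_halve u1; have [e ue p3] := punit_halve u2.
(* The halvings give 8e < x. Of this, 5 = 2 + 3 copies are reserved: adding e to both parts of a
   splitting of x - 5e turns them into order units and restores x. *)
have py : positive (x - e *+ 5).
  have : positive (x - w1 *+ 2 + (w1 - w2 *+ 2) *+ 2 + (w2 - e *+ 2) *+ 4
      + e *+ 3).
    by case: ue => pe _; do 3 (apply: positiveD; last exact: semigroupMn).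
  by congr positive; abel.
have [w _ [y2 y3]] := positive_third_half py.
exists ((w *+ 3 - (x - e *+ 5)) + e), ((x - e *+ 5 - w *+ 2) + e).
by split; [exact: punitDl..|abel].
Qed.

(** All entries are determined by c = c00. Interpolating with margin e makes each entry exceed the
    order unit e by a positive element; this is possible because 2e lies below a0, a1, b0 and b1. *)
Lemma punit_refinement a0 a1 b0 b1 :
    punit a0 -> punit a1 -> punit b0 -> punit b1 -> a0 + a1 = b0 + b1 ->
  exists c00 c01 c10 c11, [/\ punit c00, punit c01, punit c10 & punit c11] /\
    [/\ a0 = c00 + c01, a1 = c10 + c11, b0 = c00 + c10 & b1 = c01 + c11].
Proof.
move=> ua0 ua1 ub0 ub1 E.
have [d1 ud1 [a0d1 a1d1]] := punit_common_minorant ua0 ua1.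
have [d2 ud2 [b0d2 b1d2]] := punit_common_minorant ub0 ub1.
have [d ud [d1d d2d]] := punit_common_minorant ud1 ud2.
have [e ue de] := punit_halve ud.
have minor x y : positive (x - y) -> positive (y - d) -> positive (x - e *+ 2).
  move=> xy yd; move: (positiveD (positiveD xy yd) de).
  by congr positive; abel.
have Eb1 : b1 = a0 + a1 - b0 by rewrite E addrC addKr.
have f x : punit x -> finitary x by case=> /finitary_positive.
have [||||||||c _ [c1 c2 c3 c4]] :=
  @positive_interpolation e (b0 - a1 + e) (a0 - e) (b0 - e).
- exact: f.
- by apply: finitaryD; [apply: finitaryB|]; apply: f.
- by apply: finitaryB; apply: f.
- by apply: finitaryB; apply: f.
- by move: (minor _ _ a0d1 d1d); congr positive; abel.
- by move: (minor _ _ b1d2 d2d); rewrite Eb1; congr positive; abel.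
- by move: (minor _ _ b0d2 d2d); congr positive; abel.
- by move: (minor _ _ a1d1 d1d); congr positive; abel.
have shift x y : positive x -> x + e = y -> punit y.
  by move=> px <-; apply: punitDl.
exists c, (a0 - c), (b0 - c), (a1 - b0 + c); split; last first.
  by rewrite Eb1; split; abel.
split; [apply: shift c1 _|apply: shift c3 _|apply: shift c4 _|apply: shift c2 _];
  abel.
Qed.

(** * Torsion and purity in the tower *)

Lemma tower_torsion_free (p : nat) (h : tower) : (0 < p)%N ->
  (forall g : G, g *+ p = 0 -> g = 0) -> h *+ p = 0 -> h = 0.
Proof.
move=> p0 Gp hp; rewrite [h]surjective_pairing; congr pair.
  by apply: Gp; rewrite -[RHS](congr1 fst hp) raddfMn.
apply/funext => l; have := congr1 (coef l) hp.
rewrite raddfMn /= raddf0 -mulr_natr natz => /eqP.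
by rewrite mulf_eq0 => /orP[/eqP //|]; lia.
Qed.

(** The coordinates of h outside [G] are integers killed by m, hence 0, and conservativity puts h in
    stage 0. *)
Lemma punit_pure m h : (0 < m)%N -> punit h -> (exists g, h *+ m = base g) ->
  exists2 g, S g & h = base g.
Proof.
move=> m0 [[n ph] _] [g hg]; suff b0 : below 0 h.
  by have [g' Sg' <-] : stage 0 h by [apply: stage_conservative ph b0]; exists g'.
move=> l _; have /eqP := congr1 (coef l) hg.
rewrite raddfMn -mulr_natr natz mulf_eq0 => /orP[/eqP //|]; lia.
Qed.

(** * The cone of order units with a new zero *)

Lemma punitD u v : punit u -> punit v -> punit (u + v).
Proof. by case=> pu _; apply: punitDl. Qed.

(* [None] is a new zero, distinct from the zero of [tower], which may itself
   belong to [punit]. *)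
Definition cone := option {t : tower | punit t}.

HB.instance Definition _ := gen_eqMixin cone.
HB.instance Definition _ := gen_choiceMixin cone.

Definition inj_cone t (ut : punit t) : cone := Some (exist _ t ut).

Definition cone_zero : cone := None.

Definition cone_add (x y : cone) : cone :=
  match x, y with
  | None, _ => y
  | _, None => x
  | Some (exist _ ut), Some (exist _ uu) => inj_cone (punitD ut uu)
  end.

Lemma inj_cone_eq t u (ut : punit t) (uu : punit u) :
  t = u -> inj_cone ut = inj_cone uu.
Proof. by move=> E; subst u; rewrite (Prop_irrelevance ut uu). Qed.

Lemma inj_cone_inj t u (ut : punit t) (uu : punit u) :
  inj_cone ut = inj_cone uu -> t = u.
Proof. by case. Qed.

Lemma cone_addA : associative cone_add.
Proof.
by move=> [[x ux]|] [[y uy]|] [[z uz]|] //; apply: inj_cone_eq; rewrite addrA.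
Qed.

Lemma cone_addC : commutative cone_add.
Proof.
by move=> [[x ux]|] [[y uy]|] //; apply: inj_cone_eq; rewrite addrC.
Qed.

Lemma cone_add0 : left_id cone_zero cone_add.
Proof. by []. Qed.

HB.instance Definition _ :=
  GRing.isNmodule.Build cone cone_addA cone_addC cone_add0.

Lemma inj_coneD t u (ut : punit t) (uu : punit u) :
  inj_cone ut + inj_cone uu = inj_cone (punitD ut uu).
Proof. by []. Qed.

Lemma inj_coneMn t (ut : punit t) n : (0 < n)%N ->
  exists utn : punit (t *+ n), inj_cone ut *+ n = inj_cone utn.
Proof.
case: n => // n _; elim: n => [|n [utn IH]]; first by exists ut.
have u' : punit (t *+ n.+2) by rewrite mulrS; apply: punitD.
by exists u'; rewrite [LHS]mulrS IH inj_coneD; apply: inj_cone_eq; rewrite -mulrS.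
Qed.

Lemma coneP (x : cone) : x = 0 \/ exists t (ut : punit t), x = inj_cone ut.
Proof. by case: x => [[t ut]|]; [right; exists t, ut|left]. Qed.

Lemma cone_conical : conical cone.
Proof. by move=> [[x ux]|] [[y uy]|]. Qed.

(** The difference u - t need not be an order unit, but u - t + u is; hence the factor 2. *)
Lemma inj_cone_le t u (ut : punit t) (uu : punit u) :
  positive (u - t) -> alg_le (inj_cone ut) (inj_cone uu *+ 2).
Proof.
move=> pd; exists (inj_cone (punitDl pd uu)); rewrite mulr2n !inj_coneD.
by apply: inj_cone_eq; abel.
Qed.

Lemma cone_simple : simple_monoid cone.
Proof.
move=> u; have [->|[t [ut ->]] _] := coneP u; first by case; exists 0.
move=> x; have [->|[h [uh ->]]] := coneP x.
  by exists 1%N; split=> //; exists (inj_cone ut); rewrite add0r.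
have [N N_gt0 tN] := punit_dominates ut uh.1.
have [utN EN] := inj_coneMn ut N_gt0; exists (N * 2)%N; rewrite muln_gt0 N_gt0.
by rewrite mulrnA EN; split=> //; apply: inj_cone_le.
Qed.

Lemma cone_quasi_divisible : quasi_divisible cone.
Proof.
move=> x; have [->|[t [ut ->]]] := coneP x; first by exists 0, 0.
have [u [v [uu uv E]]] := punit_quasi_divisible ut.
exists (inj_cone uu), (inj_cone uv).
have [u2 ->] := @inj_coneMn _ uu 2 isT; have [v3 ->] := @inj_coneMn _ uv 3 isT.
by rewrite inj_coneD; apply: inj_cone_eq.
Qed.

Lemma cone_refinement : refinement cone.
Proof.
move=> a0 a1 b0 b1.
have [->|[x0 [ux0 ->]]] := coneP a0.
  by rewrite add0r => ->; exists 0, 0, b0, b1; rewrite !add0r.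
have [->|[x1 [ux1 ->]]] := coneP a1.
  by rewrite addr0 => ->; exists b0, b1, 0, 0; rewrite !addr0.
have [->|[y0 [uy0 ->]]] := coneP b0.
  by rewrite add0r => <-; exists 0, (inj_cone ux0), 0, (inj_cone ux1);
    rewrite !add0r.
have [->|[y1 [uy1 ->]]] := coneP b1.
  by rewrite addr0 => <-; exists (inj_cone ux0), 0, (inj_cone ux1), 0;
    rewrite !addr0.
rewrite !inj_coneD => /inj_cone_inj E.
have [c00 [c01 [c10 [c11 [[u00 u01 u10 u11] [E0 E1 E2 E3]]]]]] :=
  punit_refinement ux0 ux1 uy0 uy1 E.
exists (inj_cone u00), (inj_cone u01), (inj_cone u10), (inj_cone u11).
by rewrite !inj_coneD; split; apply: inj_cone_eq.
Qed.

Lemma cone_torsion_free (P : set nat) : (forall p, P p -> (0 < p)%N) ->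
  (forall p (g : G), P p -> g *+ p = 0 -> g = 0) -> torsion_free P cone.
Proof.
move=> P0 Gtf p Pp x y; have p0 := P0 p Pp.
have nz t (ut : punit t) : inj_cone ut *+ p <> 0.
  by have [utp ->] := inj_coneMn ut p0.
have [->|[t [ut ->]]] := coneP x; have [->|[u [uu ->]]] := coneP y.
- by [].
- by rewrite mul0rn => /esym/nz.
- by rewrite mul0rn => /nz.
have [utp ->] := inj_coneMn ut p0; have [uup ->] := inj_coneMn uu p0.
move/inj_cone_inj => E; apply: inj_cone_eq; apply/eqP; rewrite -subr_eq0.
apply/eqP/(tower_torsion_free p0 (fun g => Gtf p g Pp)).
by rewrite mulrnBl E subrr.
Qed.

(** A nonzero element of [A] may become 0 in [G], so injectivity of [i] is asked off 0 and the
    embedding is defined by cases. *)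
Lemma cone_embedding (A : nmodType) (i : {additive A -> G}) :
    conical A -> (forall g, S g <-> exists2 a, a <> 0 & i a = g) ->
    (forall a b, a <> 0 -> b <> 0 -> i a = i b -> a = b) ->
  exists f : {additive A -> cone}, strongly_unitary f.
Proof.
move=> Acon SE iI.
have Si a : a <> 0 -> S (i a) by move=> a0; apply/SE; exists a.
pose f a : cone := match pselect (a = 0) with
  | left _ => 0 | right a0 => inj_cone (punit_base (Si a a0)) end.
have f0 : f 0 = 0 by rewrite /f; case: pselect.
have fN0 a : a <> 0 -> exists u : punit (base (i a)), f a = inj_cone u.
  by move=> a0; rewrite /f; case: pselect => // a0'; exists (punit_base (Si a a0')).
have fM : nmod_morphism f.
  split=> // a b; have [->|/eqP a0] := eqVneq a 0; first by rewrite f0 !add0r.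
  have [->|/eqP b0] := eqVneq b 0; first by rewrite f0 !addr0.
  have ab0 : a + b <> 0 by move=> /Acon[].
  have [ua ->] := fN0 a a0; have [ub ->] := fN0 b b0; have [uab ->] := fN0 _ ab0.
  by rewrite inj_coneD; apply: inj_cone_eq; rewrite !raddfD.
have f_inj : injective f.
  move=> a b; have [->|/eqP a0] := eqVneq a 0; have [->|/eqP b0] := eqVneq b 0.
  - by [].
  - by have [ub ->] := fN0 b b0; rewrite f0.
  - by have [ua ->] := fN0 a a0; rewrite f0.
  have [ua ->] := fN0 a a0; have [ub ->] := fN0 b b0.
  by move/inj_cone_inj => [] /iI; apply.
(* This serves both closure conditions: m = 1 for differences, general m for division. *)
have f_pure m h : (0 < m)%N -> punit h -> (exists g, h *+ m = base g) ->
    forall uh : punit h, range f (inj_cone uh).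
  move=> m0 ph hg uh; have [g /SE[a a0 <-] E] := punit_pure m0 ph hg.
  by have [ua fa] := fN0 a a0; exists a => //; rewrite fa; apply: inj_cone_eq.
pose F : {additive A -> cone} :=
  HB.pack f (GRing.isNmodMorphism.Build A cone f fM).
exists F; split=> //.
- move=> b; have [->|[h [uh ->]]] := coneP b; first by exists 0, 0; rewrite raddf0.
  have [_ [s [_ [/SE[a a0 _] _]]]] := uh.
  have [ua fa] := fN0 a a0; have [N N_gt0 aN] := punit_dominates ua uh.1.
  have [uaN EN] := inj_coneMn ua N_gt0; exists (a *+ N *+ 2).
  by rewrite !raddfMn /= fa EN; apply: inj_cone_le.
- move=> a0 a1 b /=; have [->|[h [uh ->]]] := coneP b; first by exists 0.
  have [->|/eqP a0N] := eqVneq a0 0; first by rewrite f0 add0r => ->; exists a1.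
  have [->|/eqP a1N] := eqVneq a1 0.
    by have [u ->] := fN0 a0 a0N; rewrite f0.
  have [u ->] := fN0 a0 a0N; have [v ->] := fN0 a1 a1N.
  rewrite inj_coneD => /inj_cone_inj E; apply: (f_pure 1%N) => //.
  by exists (i a1 - i a0); rewrite raddfB /= -E addrC addKr.
- move=> m b m0; have [->|[h [uh ->]]] := coneP b; first by exists 0.
  have [uhm ->] := inj_coneMn uh m0 => -[a _].
  have [->|/eqP a0] := eqVneq a 0; first by rewrite /= f0.
  rewrite /=; have [u ->] := fN0 a a0 => /inj_cone_inj E.
  by apply: (f_pure m) => //; exists (i a).
Qed.

Lemma tower_embedding (P : set nat) (A : nmodType) (i : {additive A -> G}) :
    (forall p, P p -> (0 < p)%N) ->
    (forall p (g : G), P p -> g *+ p = 0 -> g = 0) ->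
    conical A -> (forall g, S g <-> exists2 a, a <> 0 & i a = g) ->
    (forall a b, a <> 0 -> b <> 0 -> i a = i b -> a = b) ->
  exists (B : nmodType) (f : {additive A -> B}),
    [/\ conical B, simple_monoid B, torsion_free P B, quasi_divisible B
      & refinement B] /\ strongly_unitary f.
Proof.
move=> P0 Gtf Acon SE iI; have [f uf] := cone_embedding Acon SE iI.
exists cone, f; split=> //; split.
- exact: cone_conical.
- exact: cone_simple.
- exact: cone_torsion_free.
- exact: cone_quasi_divisible.
- exact: cone_refinement.
Qed.

End Tower.

(** * The Grothendieck group of a commutative monoid *)

Section Grothendieck.
Local Open Scope quotient_scope.
Variable A : nmodType.

(** The summand [e] makes the relation transitive even when [A] is not cancellative. *)
Definition groth_equiv (u v : A * A) : bool :=
  `[< exists e, u.1 + v.2 + e = v.1 + u.2 + e >].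

Lemma groth_equiv_refl : reflexive groth_equiv.
Proof. by move=> u; apply/asboolP; exists 0. Qed.

Lemma groth_equiv_sym : symmetric groth_equiv.
Proof.
by move=> u v; apply/asboolP/asboolP => -[e E]; exists e; rewrite E.
Qed.

Lemma groth_equiv_trans : transitive groth_equiv.
Proof.
move=> v u w /asboolP[e E] /asboolP[e' E']; apply/asboolP.
(* Adding the two given equations leaves exactly these terms on both sides. *)
exists (v.1 + v.2 + (e + e')).
rewrite (_ : _ + _ = u.1 + v.2 + e + (v.1 + w.2 + e')); last first.
  by rewrite [LHS](AC (2*(2*2)) ((1*4*5)*(3*2*6))).
by rewrite E E' [LHS](AC (3*3) ((4*2)*((1*5)*(3*6)))).
Qed.

Canonical groth_equiv_rel :=
  EquivRel groth_equiv groth_equiv_refl groth_equiv_sym groth_equiv_trans.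

Definition groth := {eq_quot groth_equiv}.

HB.instance Definition _ := Choice.on groth.
HB.instance Definition _ := EqQuotient.on groth.

Lemma groth_eqP u v : reflect (exists e, u.1 + v.2 + e = v.1 + u.2 + e)
  (\pi_groth u == \pi_groth v).
Proof. by rewrite eqmodE; apply: asboolP. Qed.

Definition groth_pair (a b : A) : groth := \pi_groth (a, b).

Lemma grothP (x : groth) : exists a b, x = groth_pair a b.
Proof.
by exists (repr x).1, (repr x).2; rewrite /groth_pair -surjective_pairing reprK.
Qed.

Lemma groth_pair_eq a b c d :
  groth_pair a b = groth_pair c d <-> exists e, a + d + e = c + b + e.
Proof. by split=> [/eqP/groth_eqP|/(@groth_eqP (a, b) (c, d))/eqP]. Qed.

Definition groth_add (x y : groth) : groth :=
  groth_pair ((repr x).1 + (repr y).1) ((repr x).2 + (repr y).2).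

Definition groth_opp (x : groth) : groth := groth_pair (repr x).2 (repr x).1.

Lemma groth_repr a b : exists e,
  (repr (groth_pair a b)).1 + b + e = a + (repr (groth_pair a b)).2 + e.
Proof.
by apply/groth_pair_eq; rewrite /groth_pair -surjective_pairing reprK.
Qed.

Lemma groth_addE a b c d :
  groth_add (groth_pair a b) (groth_pair c d) = groth_pair (a + c) (b + d).
Proof.
have [e E] := groth_repr a b; have [e' E'] := groth_repr c d.
apply/groth_pair_eq; exists (e + e').
rewrite [LHS](AC (2*2*2) ((1*3*5)*(2*4*6))) /= E E'.
by rewrite [LHS](AC (3*3) ((1*4)*(2*5)*(3*6))).
Qed.

Lemma groth_oppE a b : groth_opp (groth_pair a b) = groth_pair b a.
Proof.
have [e E] := groth_repr a b; apply/groth_pair_eq; exists e.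
by rewrite [LHS](AC (2*1) ((2*1)*3)) /= -E [LHS](AC (2*1) ((2*1)*3)).
Qed.

Lemma groth_addA : associative groth_add.
Proof.
move=> x y z; have [a [b ->]] := grothP x; have [c [d ->]] := grothP y.
by have [e [f ->]] := grothP z; rewrite !groth_addE !addrA.
Qed.

Lemma groth_addC : commutative groth_add.
Proof.
move=> x y; have [a [b ->]] := grothP x; have [c [d ->]] := grothP y.
by rewrite !groth_addE [a + c]addrC [b + d]addrC.
Qed.

Lemma groth_add0 : left_id (groth_pair 0 0) groth_add.
Proof. by move=> x; have [a [b ->]] := grothP x; rewrite groth_addE !add0r. Qed.

Lemma groth_addN : left_inverse (groth_pair 0 0) groth_opp groth_add.
Proof.
move=> x; have [a [b ->]] := grothP x; rewrite groth_oppE groth_addE.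
by apply/groth_pair_eq; exists 0; rewrite !addr0 add0r addrC.
Qed.

HB.instance Definition _ :=
  GRing.isZmodule.Build groth groth_addA groth_addC groth_add0 groth_addN.

Definition to_groth (a : A) : groth := groth_pair a 0.

Lemma to_groth_nmod_morphism : nmod_morphism to_groth.
Proof.
by split=> // a b; rewrite [RHS]groth_addE addr0.
Qed.

HB.instance Definition _ := GRing.isNmodMorphism.Build A groth to_groth
  to_groth_nmod_morphism.

Lemma to_groth_eq a b : to_groth a = to_groth b <-> exists e, a + e = b + e.
Proof. by rewrite groth_pair_eq !addr0. Qed.

Lemma groth_sub (x : groth) : exists a b, x = to_groth a - to_groth b.
Proof.
have [a [b ->]] := grothP x; exists a, b.
rewrite [- _]groth_oppE [RHS]groth_addE.
by rewrite addr0 add0r.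
Qed.

End Grothendieck.

(** * Cancellation in simple torsion-free cones *)

Lemma subsemigroup_unbounded (P : set nat) : mul_subsemigroup P ->
  ~ (P `<=` [set 1%N]) -> forall N, exists2 m, P m & (N <= m)%N.
Proof.
move=> [P0 PM] /existsNP[p /not_implyP[Pp p1]] N.
have p2 : (1 < p)%N by have := P0 p Pp; move/eqP: p1; lia.
elim: N => [|N [m Pm Nm]]; first by exists p.
by exists (m * p)%N; [apply: PM|have := P0 m Pm; nia].
Qed.

Section SimpleCone.
Variables (P : set nat) (A : nmodType).
Hypotheses (hP : mul_subsemigroup P) (hP1 : ~ (P `<=` [set 1%N])).
Hypotheses (Acone : conical A) (Asimple : simple_monoid A).
Hypothesis Atf : torsion_free P A.

Lemma simple_order_unit (a : A) : a <> 0 -> order_unit a.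
Proof. by move=> a0; apply: Asimple => -[z /Acone[]]. Qed.

(* Multiples of [a] absorb [e], so that [a *+ m = b *+ m] for all large [m],
   hence for some [m] in [P]. *)
Lemma simple_cancel (a b e : A) : a <> 0 -> b <> 0 -> a + e = b + e -> a = b.
Proof.
move=> a0 b0 E.
have absorb c : c <> 0 -> exists n, a + c *+ n = b + c *+ n.
  move=> /simple_order_unit/(_ e)[n [_ [z Ez]]].
  by exists n; rewrite -Ez !addrA E.
(* In the presence of [c *+ n], copies of a are exchanged for b one at a time. *)
have step c n k : a + c *+ n = b + c *+ n -> c *+ n + a *+ k = c *+ n + b *+ k.
  move=> Ec; elim: k => // k IH.
  rewrite !mulrSr !addrA IH [LHS]addrAC [c *+ n + a]addrC Ec.
  by rewrite [b + c *+ n]addrC addrAC.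
have [n1 E1] := absorb a a0; have [n2 E2] := absorb b b0.
have [m Pm nm] := subsemigroup_unbounded hP hP1 (n1 + n2).
(* Write m = n1 + n2 + r. In the presence of n1 copies of a, the other n2 + r become b; n2 of these
   then let the first n1 become b. *)
apply: (Atf Pm); rewrite -(subnKC nm) -!addnA !mulrnDr.
by rewrite -[in LHS]mulrnDr (step a) // mulrnDr addrCA addrA (step b) // -addrA
  addrCA.
Qed.

End SimpleCone.

(** * The tower over the Grothendieck group of a simple cone *)

Theorem corollary3p10 (P : set nat) (hP : mul_subsemigroup P)
    (hP1 : ~ (P `<=` [set 1%N]))
    (A : nmodType) (hAcone : conical A) (hAsimple : simple_monoid A)
    (hAtf : torsion_free P A) :
  exists (B : nmodType) (f : {additive A -> B}),
    [/\ conical B, simple_monoid B, torsion_free P B, quasi_divisible B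
      & refinement B] /\ strongly_unitary f.
Proof.
pose S : set (groth A) := fun g => exists2 a, a <> 0 & to_groth a = g.
have SD x y : S x -> S y -> S (x + y).
  move=> [a a0 <-] [b b0 <-]; exists (a + b); last by rewrite raddfD.
  by move=> /hAcone[].
have Sarch s x : S s -> S x -> exists n, S (s *+ n - x).
  move=> [a a0 <-] [b b0 <-]; have := simple_order_unit hAcone hAsimple a0.
  (* One copy of a beyond n is used because z may be 0, whereas a + z is not. *)
  move=> /(_ b)[n [_ [z E]]]; exists n.+1, (a + z); first by move=> /hAcone[].
  by rewrite -raddfMn mulrS -E !raddfD /=; abel.
apply: (tower_embedding SD Sarch (i := @to_groth A)) => //.
- by case: hP.
- move=> p x Pp; have [a [b ->]] := groth_sub x; have p0 := hP.1 p Pp.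
  rewrite mulrnBl => /subr0_eq; rewrite -!raddfMn => /to_groth_eq[e E].
  (* Adding p - 1 further copies of e to both sides of E produces p-fold multiples, to which
     torsion-freeness of [A] applies. *)
  have /(hAtf p Pp) E' : (a + e) *+ p = (b + e) *+ p.
    have Ep : e *+ p = e + e *+ p.-1 by rewrite -mulrS prednK.
    by rewrite !mulrnDl Ep !addrA E.
  by apply/eqP; rewrite subr_eq0; apply/eqP/to_groth_eq; exists e.
- move=> a b a0 b0 /to_groth_eq[e].
  exact: simple_cancel hP hP1 hAcone hAsimple hAtf _ _ _ a0 b0.
Qed.
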